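(* Let $(G,\mathcal{O},W)$ be a graph with geometry. (a) If $D,D'$ are domains in $G$ with nonempty boundary and $\mathrm{pspec}(D)=\mathrm{pspec}(D')$, then $\mathrm{spec}^*(D)=\mathrm{spec}^*(D')$. (b) For a positive integer $N$ let $\mathcal{D}_N$ be the collection of all domains $D\subset G$ with nonempty boundary such that $\mathrm{card}(\mathrm{spec}^*(D))=N$. Then there are $N$ rational functions $f_0,\dots,f_{N-1}$ in $2N$ real variables such that for every $D\in\mathcal{D}_N$ the $f_i$ are defined at $(A_{2,0}(D),\dots,A_{2,2N-1}(D))$ and the roots of the polynomial $$P_N(x)=x^N+\sum_{i=0}^{N-1}f_i(A_{2,0}(D),A_{2,1}(D),\dots,A_{2,2N-1}(D))\,x^i$$ are exactly the elements of $\mathrm{spec}^*(D)$. (c) Let $\alpha>0$. When the domains under consideration are $\alpha$-weight regular, the same claims hold with $\mathrm{mspec}$ replacing $\mathrm{pspec}$: if $D,D'$ are $\alpha$-weight regular domains in $G$ with nonempty boundary and $\mathrm{mspec}(D)=\mathrm{mspec}(D')$ then $\mathrm{spec}^*(D)=\mathrm{spec}^*(D')$; and for each $N$ there are $N$ rational functions $f_0,\dots,f_{N-1}$ in $2N$ real variables such that for every $\alpha$-weight regular $D\in\mathcal{D}_N$ the roots of $x^N+\sum_{i=0}^{N-1}f_i(A_{1,0}(D),\dots,A_{1,2N-1}(D))x^i$ are exactly the elements of $\mathrm{spec}^*(D)$.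
   Context: A bidirected graph $G=(V,E)$ has edge set $E\subset V\times V$ with $(x,y)\in E$ iff $(y,x)\in E$, no self edges $(x,x)$, and every vertex of finite degree ($V$ may be infinite). An orientation is a subset $\mathcal{O}\subset E$ containing exactly one of $(x,y),(y,x)$ for each edge. A weighting is a pair $W=(W_V,W_E)$ with $W_V:V\to(0,\infty)$ and $W_E:V\times V\to[0,\infty)$ positive exactly on $E$, such that $W_E(x,y)W_V(x)=W_E(y,x)W_V(y)$ for all $x,y\in V$. A graph with geometry is a triple $(G,\mathcal{O},W)$ with $G$ connected bidirected, $\mathcal{O}$ an orientation, $W$ a weighting. The auxiliary weighting is $w_V(x)=\sum_{(x,y)\in E}W_E(x,y)$. For a bidirected subgraph $D=(V',E')$ of $G$, a vertex $x\in V'$ is interior if for all $y\in V$ with $(x,y)\in E$ one has $y\in V'$ and $(x,y)\in E'$. $iD$ is the set of interior vertices, and $\partial D=V'\setminus iD$ is the boundary. A domain of $G$ is a finite connected bidirected subgraph with $iD\neq\emptyset$. $D$ is $\alpha$-weight regular if $w_V(x)=\alpha$ for all $x\in iD$. $C^0(iD)$ is the space of real functions on $iD$, with inner product $\langle f,g\rangle_{iD}=\sum_{x\in iD}f(x)g(x)W_V(x)$. The interior Laplace operator $\Delta_{iD}:C^0(iD)\to C^0(iD)$ is $\Delta_{iD}f(x)=w_V(x)f(x)-\sum_{y\in iD}W_E(x,y)f(y)$; it is self-adjoint. $\mathrm{spec}^*(D)$ is the set (without multiplicity) of eigenvalues $\lambda$ of $\Delta_{iD}$ whose eigenspace contains some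 $\phi$ with $\langle\phi,1\rangle_{iD}\neq0$. $X_n$ is the Markov chain on $V$ with transition probabilities $p(x,y)=W_E(x,y)/w_V(x)$; $E^x$ is expectation for the chain started at $x$. $\eta=\inf\{n\ge0:X_n\notin iD\}$ and $\tau=\sum_{n=0}^{\eta-1}\frac{1}{w_V(X_n)}$. For integers $k\ge0$, $$A_{1,k}(D)=\sum_{x\in iD}E^x[\tau^k]W_V(x),\qquad A_{2,k}(D)=k!\sup_{f\in C^0(iD)\setminus\{0\}}\frac{\langle f,1\rangle_{iD}^2}{|\langle f,\Delta_{iD}^kf\rangle_{iD}|}.$$ The moment spectrum is $\mathrm{mspec}(D)=\{A_{1,k}(D)\}_{k\ge1}$ and the Poisson spectrum is $\mathrm{pspec}(D)=\{A_{2,k}(D)\}_{k\ge1}$, as sequences. *)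

(* Defs.v *)
From HB Require Import structures.
From mathcomp Require Import all_boot all_order all_algebra finmap.
From mathcomp Require Import all_classical all_reals all_analysis.
From mathcomp Require mpoly.
Import (canonicals, coercions) mpoly.
Set Implicit Arguments.
Unset Strict Implicit.
Unset Printing Implicit Defensive.
Import Order.TTheory GRing.Theory Num.Theory.
Local Open Scope classical_set_scope.
Local Open Scope fset_scope.
Local Open Scope ring_scope.

Record bidirected_graph (V : choiceType) := BidirectedGraph {
  edge :> rel V;
  edge_sym : symmetric edge;
  edge_irr : irreflexive edge;
  edge_fin : forall x, finite_set [set y | edge x y] }.

Definition connected_graph (V : choiceType) (G : bidirected_graph V) : Prop :=
  forall x y : V, exists2 p : seq V, path G x p & last x p = y.

Definition is_orientation (V : choiceType) (G : bidirected_graph V)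
    (O : rel V) : Prop :=
  (forall x y, O x y -> G x y) /\ (forall x y, G x y -> O x y (+) O y x).

Record weighting (R : realType) (V : choiceType) (G : bidirected_graph V) :=
  Weighting {
    WV : V -> R;
    WE : V -> V -> R;
    WV_gt0 : forall x, 0 < WV x;
    WE_ge0 : forall x y, 0 <= WE x y;
    WE_gt0 : forall x y, (0 < WE x y) = G x y;
    WE_WV : forall x y, WE x y * WV x = WE y x * WV y }.

Record graph_with_geometry (R : realType) (V : choiceType) :=
  GraphWithGeometry {
    ggraph :> bidirected_graph V;
    gconnected : connected_graph ggraph;
    gorient : rel V;
    gorientP : is_orientation ggraph gorient;
    gweight : weighting R ggraph }.

Record finite_subgraph (V : choiceType) (G : bidirected_graph V) :=
  FiniteSubgraph {
    sverts : {fset V};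
    sedge : rel V;
    sedge_sym : symmetric sedge;
    sedge_sub : forall x y,
      sedge x y -> [/\ G x y, x \in sverts & y \in sverts] }.

Section Subgraph.
Context (V : choiceType) (G : bidirected_graph V) (D : finite_subgraph G).

Definition interior_verts : {fset V} :=
  [fset x in sverts D |
    `[< forall y, G x y -> y \in sverts D /\ sedge D x y >]]%fset.

Definition boundary_verts : {fset V} := (sverts D `\` interior_verts)%fset.

Definition connected_subgraph : Prop :=
  forall x y, x \in sverts D -> y \in sverts D ->
    exists2 p : seq V, path (sedge D) x p & last x p = y.

Definition is_domain : Prop := connected_subgraph /\ interior_verts != fset0.

End Subgraph.

Section Spectrum.
Context (R : realType) (V : choiceType) (G : graph_with_geometry R V).

Local Notation mV := (WV (gweight G)).
Local Notation mE := (WE (gweight G)).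

Definition wV (x : V) : R := \sum_(y \in [set y | G x y]) mE x y.

Section Domain.
Context (D : finite_subgraph G).
Local Notation iD := (interior_verts D).

Definition inner (f g : {ffun iD -> R}) : R :=
  \sum_(x : iD) f x * g x * mV (val x).

Definition one_iD : {ffun iD -> R} := [ffun=> 1].

Definition laplace (f : {ffun iD -> R}) : {ffun iD -> R} :=
  [ffun x => wV (val x) * f x - \sum_(y : iD) mE (val x) (val y) * f y].

Definition spec_star : set R :=
  [set lambda | exists phi : {ffun iD -> R},
     (forall x, laplace phi x = lambda * phi x) /\ inner phi one_iD != 0].

Definition weight_regular (alpha : R) : Prop :=
  forall x, x \in iD -> wV x = alpha.

(* With nonempty boundary the denominator is nonzero for every nonzero [f], so
   the convention [x / 0 = 0] plays no role. *)
Definition A2_quotient (k : nat) (f : {ffun iD -> R}) : R :=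
  inner f one_iD ^+ 2 / `|inner f (iter k laplace f)|.

Definition A2 (k : nat) : \bar R :=
  ((k`!%:R)%:E *
   ereal_sup [set (A2_quotient k f)%:E
             | f in [set f : {ffun iD -> R} | f != [ffun=> 0%R]]])%E.

Definition pspec : nat -> \bar R := fun k => A2 k.+1.

End Domain.

Definition transition (x y : V) : R := mE x y / wV x.

(* A realization of the chain: one measurable space and one process [proc],
   with the law [law x] of the chain started at [x] for every vertex [x].
   [V] carries its discrete sigma-algebra. *)
Record markov_chain := MarkovChain {
  mc_disp : measure_display;
  mc_space : measurableType mc_disp;
  law : V -> probability mc_space R;
  proc : nat -> mc_space -> V;
  proc_measurable : forall n (B : set V), measurable (proc n @^-1` B);
  proc_start : forall x, law x [set w | proc 0%N w = x] = 1%E;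
  proc_markov : forall x (v : nat -> V) (n : nat),
    law x [set w | forall i, (i <= n.+1)%N -> proc i w = v i] =
    (law x [set w | forall i, (i <= n)%N -> proc i w = v i] *
     (transition (v n) (v n.+1))%:E)%E }.

Section Moments.
Context (X : markov_chain) (D : finite_subgraph G).

(* [+oo] on trajectories that never leave the interior. *)
Definition exit_time (w : mc_space X) : \bar R :=
  ereal_inf [set n%:R%:E | n in [set n | proc n w \notin interior_verts D]].

Definition weighted_exit_time (w : mc_space X) : \bar R :=
  (\sum_(0 <= n <oo | (n%:R%:E < exit_time w)%E) ((wV (proc n w))^-1)%:E)%E.

Definition A1 (k : nat) : \bar R :=
  (\sum_(x : interior_verts D)
     (\int[law X (val x)]_w (weighted_exit_time w ^+ k)) *
     (mV (val x))%:E)%E.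

Definition mspec : nat -> \bar R := fun k => A1 k.+1.

End Moments.

End Spectrum.

Definition ratfun (R : realType) (n : nat) : Type :=
  {fraction (mpoly.mpoly n R)}.

(* [f] is defined at [a], with value [v]. *)
Definition ratfun_value (R : realType) (n : nat) (f : ratfun R n)
    (a : 'I_n -> R) (v : R) : Prop :=
  exists p q : mpoly.mpoly n R,
    [/\ mpoly.meval a q != 0,
        f = FracField.tofrac p / FracField.tofrac q
      & v = mpoly.meval a p / mpoly.meval a q].

(* Plugging [A 0, ..., A (2 * N - 1)] into real rational functions requires
   them to be finite, which is part of the claim. *)
Definition recovers (R : realType) (N : nat) (f : 'I_N -> ratfun R (2 * N))
    (A : nat -> \bar R) (S : set R) : Prop :=
  exists (a : 'I_(2 * N) -> R) (c : 'I_N -> R),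
    [/\ forall j : 'I_(2 * N), A j = (a j)%:E,
        forall i : 'I_N, ratfun_value (f i) a (c i)
      & [set x | root ('X^N + \sum_(i < N) c i *: 'X^i) x] = S].

(* Main.v *)
(* Write the constant function 1 on iD as a sum of eigenfunctions e_l of the
   Dirichlet Laplacian, one for each l in spec^*, and put a_l = <e_l, 1> > 0.
   The Laplacian is positive definite because the boundary is nonempty and D is
   connected, so Cauchy-Schwarz for the form <f, Delta^k g> gives
   A_{2,k} = k! m_k with m_k = <1, Delta^-k 1> = sum_l a_l l^-k.  On an
   alpha-weight regular domain P(eta > n), summed against W_V, equals
   sum_l a_l (1 - l/alpha)^n, so that the rising factorial moments of eta are
   again k! alpha^k m_k, and the m_k are linear combinations of the A_{1,j}.
   Finally the moments m_k of the measure with atoms a_l at 1/l determine its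
   support, and when there are N atoms the coefficients of prod_l (x - l) solve
   a linear system with Hankel matrix in m_0, ..., m_{2N-1}, invertible because
   the a_l are positive. *)
Require Import Defs.
From HB Require Import structures.
From mathcomp Require Import all_boot all_order all_algebra finmap.
From mathcomp Require Import all_classical all_reals all_analysis.
From mathcomp Require Import measurable_realfun.
From mathcomp Require mpoly complex.
Import (canonicals, coercions) mpoly.
Import (canonicals) complex.
From mathcomp Require Import ring lra zify.
Set Implicit Arguments.
Unset Strict Implicit.
Unset Printing Implicit Defensive.
Import Order.TTheory GRing.Theory Num.Theory.
Import numFieldNormedType.Exports.
Local Open Scope classical_set_scope.
Local Open Scope ring_scope.

(** * Spectral decomposition *)

Lemma sumr_seq_gt0 (R : numDomainType) (I : eqType) (s : seq I) (F : I -> R) :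
  s != [::] -> (forall i, i \in s -> 0 < F i) -> 0 < \sum_(i <- s) F i.
Proof.
case: s => // i s _ F_gt0; rewrite big_cons ltr_pwDl ?F_gt0 ?mem_head //.
by rewrite big_seq sumr_ge0 // => j js; rewrite ltW // F_gt0 // inE js orbT.
Qed.

(** The spectral theorem is applied to the Hermitian complexification of [S]. Its eigenvalues are
    real, so the real parts of the components of [u] along the eigenbasis are again eigenvectors,
    possibly zero, and still sum to [u]. *)
Lemma symmetric_eigen_sum (R : rcfType) n (S : 'M[R]_n) (u : 'rV[R]_n) :
  S^T = S ->
  exists (d : 'I_n -> R) (v : 'I_n -> 'rV[R]_n),
    (forall i, v i *m S = d i *: v i) /\ u = \sum_i v i.
Proof.
move=> Ssym; pose toC : {rmorphism R -> complex.complex R} := complex.real_complex R.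
pose A := map_mx toC S.
have realC x : toC x \is Num.real by rewrite complex.complex_real.
have Aherm : A \is hermsymmx.
  apply: realsym_hermsym; last by apply/mxOverP => i j; rewrite mxE.
  by apply/is_hermitianmxP; rewrite expr0 scale1r map_mx_id// map_trmx Ssym.
have /orthomx_spectralP := hermitian_normalmx Aherm.
have := hermitian_spectral_diag_real Aherm.
have := spectral_unit A.
set P := spectralmx A; set D := spectral_diag A => Punit Dreal AE.
exists (fun i => complex.Re (D 0 i)).
pose c : 'rV_n := map_mx toC u *m invmx P.
exists (fun i => map_mx (@complex.Re R) (c 0 i *: row i P)).
have ReM (x : R) z : complex.Re (toC x * z) = x * complex.Re z.
  by case: z => a b /=; rewrite mul0r subr0.
split=> [i|].
  have PA : row i P *m A = D 0 i *: row i P.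
    rewrite -row_mul AE !mulmxA mulmxV // mul1mx row_mul.
    by rewrite row_diag_mx -scalemxAl -rowE.
  have DiE : D 0 i = toC (complex.Re (D 0 i)).
    by apply/esym/complex.RRe_real; exact: (mxOverP Dreal).
  apply/rowP => j; rewrite [RHS]mxE [X in _ * X]mxE -ReM -DiE.
  have -> : D 0 i * (c 0 i *: row i P) 0 j = ((c 0 i *: row i P) *m A) 0 j.
    by rewrite -scalemxAl PA !mxE; ring.
  rewrite !mxE (raddf_sum (@complex.Re R)).
  apply: eq_bigr => k _; rewrite !mxE mulrC -ReM; congr complex.Re; exact: mulrC.
apply/rowP => j; rewrite summxE.
have <- : complex.Re (map_mx toC u 0 j) = u 0 j by rewrite mxE.
rewrite -[map_mx toC u](mulmxKV Punit) -/c mxE (raddf_sum (@complex.Re R)).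
by apply: eq_bigr => i _; rewrite !mxE.
Qed.

Section SelfAdjoint.
Context (R : realType) (I : finType) (W : I -> R) (A : I -> I -> R)
  (L : {ffun I -> R} -> {ffun I -> R}).
Context (W_gt0 : forall x, 0 < W x)
  (A_sym : forall x y, A x y * W x = A y x * W y)
  (LE : forall f x, L f x = \sum_y A x y * f y).
Implicit Types (f g h : {ffun I -> R}) (S : seq R) (e : R -> {ffun I -> R}).

Definition dotW f g : R := \sum_x f x * g x * W x.

Lemma dotWC f g : dotW f g = dotW g f.
Proof. by apply: eq_bigr => x _; rewrite (mulrC (f x)). Qed.

Lemma dotW_ge0 f : 0 <= dotW f f.
Proof. by apply: sumr_ge0 => x _; rewrite mulr_ge0 ?(ltW (W_gt0 x)) // -expr2 sqr_ge0. Qed.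

Lemma dotW_gt0 f : f != [ffun=> 0] -> 0 < dotW f f.
Proof.
move=> f0; rewrite lt0r dotW_ge0 andbT; apply: contra f0.
rewrite psumr_eq0 => [/allP f0|x _]; last first.
  by rewrite mulr_ge0 ?(ltW (W_gt0 x)) // -expr2 sqr_ge0.
apply/eqP/ffunP => x; rewrite ffunE; have := f0 x (mem_index_enum x).
by rewrite /= !mulf_eq0 (gt_eqF (W_gt0 x)) orbF orbb => /eqP.
Qed.

Lemma dotWZr l f g : dotW f [ffun x => l * g x] = l * dotW f g.
Proof. by rewrite mulr_sumr; apply: eq_bigr => x _; rewrite ffunE; ring. Qed.

Lemma dotW_self_adjoint f g : dotW (L f) g = dotW f (L g).
Proof.
rewrite /dotW; under eq_bigr do rewrite LE !mulr_suml.
under [RHS]eq_bigr do rewrite LE mulr_sumr mulr_suml.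
rewrite exchange_big; apply: eq_bigr => x _; apply: eq_bigr => y _.
have -> : A y x * f x * g y * W y = (A y x * W y) * f x * g y by ring.
by rewrite -A_sym; ring.
Qed.

Lemma dotW_iter k f g : dotW (iter k L f) g = dotW f (iter k L g).
Proof. by elim: k f g => //= k IH f g; rewrite dotW_self_adjoint IH -iterSr. Qed.

Lemma eigen_orthogonal f g l m : l != m ->
  (forall x, L f x = l * f x) -> (forall x, L g x = m * g x) -> dotW f g = 0.
Proof.
move=> lm Lf Lg; have := dotW_self_adjoint f g.
have -> : dotW (L f) g = l * dotW f g.
  by rewrite mulr_sumr; apply: eq_bigr => x _; rewrite Lf; ring.
have -> : dotW f (L g) = m * dotW f g.
  by rewrite mulr_sumr; apply: eq_bigr => x _; rewrite Lg; ring.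
by move/eqP; rewrite -subr_eq0 -mulrBl mulf_eq0 subr_eq0 (negPf lm) => /eqP.
Qed.

Lemma iter_linear k f g t : iter k L [ffun x => f x + t * g x] =
  [ffun x => iter k L f x + t * iter k L g x].
Proof.
elim: k => //= k ->; apply/ffunP => x; rewrite ffunE !LE mulr_sumr -big_split.
by apply: eq_bigr => y _ /=; rewrite ffunE; ring.
Qed.

(** Self-adjointness moves half of the factors [L] to the left, which leaves <h, h> or <h, L h> with
    [h] an iterate of [f]. *)
Lemma dotW_iter_ge0 k f : (forall g, 0 <= dotW g (L g)) ->
  0 <= dotW f (iter k L f).
Proof.
move=> L_ge0; rewrite -(odd_double_half k) -addnn addnC -addnA iterD -dotW_iter.
by rewrite addnC iterD; case: odd => //=; exact: dotW_ge0.
Qed.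

(** The form is nonnegative at [f - (p / m) g], the minimiser along the line through [f] in
    direction [g]; multiplying by [m] gives the inequality. *)
Lemma dotW_cauchy_schwarz k f g : (forall h, 0 <= dotW h (L h)) ->
  0 < dotW g (iter k L g) ->
  dotW f (iter k L g) ^+ 2 <= dotW f (iter k L f) * dotW g (iter k L g).
Proof.
move=> L_ge0 g_gt0; set m := dotW g _ in g_gt0 *; set p := dotW f (iter k L g).
have := dotW_iter_ge0 k [ffun x => f x + (- (p / m)) * g x] L_ge0.
rewrite iter_linear; set t := - (p / m).
have -> : dotW [ffun x => f x + t * g x]
    [ffun x => iter k L f x + t * iter k L g x] =
    dotW f (iter k L f) + t * p + t * dotW g (iter k L f) + t ^+ 2 * m.
  rewrite /p /m /dotW !mulr_sumr -!big_split; apply: eq_bigr => x _ /=.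
  by rewrite !ffunE; ring.
have -> : dotW g (iter k L f) = p by rewrite -dotW_iter dotWC.
move=> h.
rewrite -subr_ge0; apply: le_trans (mulr_ge0 h (ltW g_gt0)) _.
by rewrite le_eqVlt; apply/orP; left; apply/eqP; rewrite /t; field; rewrite gt_eqF.
Qed.

(** Indexing coefficients by eigenvalue gives a functional calculus: when the [e l] sum to [g],
    [eigen_comb S e c] is c(L) g. *)
Definition eigen_comb S e (c : R -> R) : {ffun I -> R} :=
  [ffun x => \sum_(l <- S) c l * e l x].

Lemma iter_eigen_comb S e c k :
  (forall l, l \in S -> forall x, L (e l) x = l * e l x) ->
  iter k L (eigen_comb S e c) = eigen_comb S e (fun l => c l * l ^+ k).
Proof.
move=> Le; elim: k => [|k IH] /=.
  by apply/ffunP => x; rewrite !ffunE; apply: eq_bigr => l _; rewrite mulr1.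
apply/ffunP => x; rewrite {}IH LE ffunE.
under eq_bigr do rewrite ffunE mulr_sumr.
rewrite exchange_big; apply: eq_big_seq => l lS /=.
rewrite exprSr mulrA -mulrA -Le // LE mulr_sumr.
by apply: eq_bigr => y _; ring.
Qed.

Lemma dotW_eigen_comb S e c f :
  dotW (eigen_comb S e c) f = \sum_(l <- S) c l * dotW (e l) f.
Proof.
rewrite /dotW; under eq_bigr do rewrite ffunE !mulr_suml.
rewrite exchange_big; apply: eq_bigr => l _; rewrite mulr_sumr.
by apply: eq_bigr => x _; ring.
Qed.

(** Each [e l] is the projection of [g] to the eigenspace of [l], and [S] keeps the nonzero ones.
    Eigenspaces being orthogonal, <f, g> = <f, e_l> for every eigenfunction [f] of eigenvalue [l];
    so [S] lists the eigenvalues whose eigenspace is not orthogonal to [g], and <e_l, g> = <e_l,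
    e_l> > 0. *)
Lemma spectral_resolution g : exists S e,
  [/\ uniq S,
      forall l, l \in S -> forall x, L (e l) x = l * e l x,
      forall l, l \in S -> 0 < dotW (e l) g,
      g = eigen_comb S e (fun=> 1)
    & [set` S] = [set l | exists2 f, forall x, L f x = l * f x & dotW f g != 0]].
Proof.
pose n := #|I|; pose s (i : 'I_n) := Num.sqrt (W (enum_val i)).
have s_neq0 i : s i != 0 by rewrite gt_eqF // sqrtr_gt0.
have sW i : W (enum_val i) = s i * s i by rewrite -expr2 sqr_sqrtr // ltW.
(* Conjugation by the square root of [W] makes [A] symmetric; the indices are swapped because the
   eigenvectors are rows. Dividing by [s] below turns them back into eigenfunctions of [L]. *)
pose M : 'M[R]_n := \matrix_(i, j) (A (enum_val j) (enum_val i) * s j / s i).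
have M_sym : M^T = M.
  apply/matrixP => i j; rewrite !mxE.
  have := A_sym (enum_val i) (enum_val j); rewrite !sW => h.
  by apply/eqP; rewrite eqr_div // -!mulrA h.
have [d [v [Mv gv]]] := symmetric_eigen_sum (\row_i (s i * g (enum_val i))) M_sym.
pose w i : {ffun I -> R} := [ffun x => v i 0 (enum_rank x) / s (enum_rank x)].
have Lw i x : L (w i) x = d i * w i x.
  have := congr1 (fun u : 'rV_n => u 0 (enum_rank x)) (Mv i).
  rewrite /w LE ffunE [RHS]mxE mxE mulrA => <-.
  rewrite mulr_suml (reindex (@enum_val I I)) /=; last first.
    by exists enum_rank => y _; rewrite ?enum_rankK ?enum_valK.
  apply: eq_bigr => j _; rewrite !mxE ffunE enum_rankK enum_valK.
  by field; rewrite !s_neq0.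
have gw x : g x = \sum_i w i x.
  have := congr1 (fun u : 'rV_n => u 0 (enum_rank x) / s (enum_rank x)) gv.
  rewrite !mxE enum_rankK mulrAC divff // mul1r => ->.
  by rewrite summxE mulr_suml; apply: eq_bigr => i _; rewrite ffunE.
pose e l : {ffun I -> R} := [ffun x => \sum_(i | d i == l) w i x].
pose S := [seq l <- undup [seq d i | i <- enum 'I_n] | e l != [ffun=> 0]].
have Suniq : uniq S by rewrite filter_uniq ?undup_uniq.
have Le l x : L (e l) x = l * e l x.
  rewrite LE ffunE mulr_sumr; under eq_bigr do rewrite ffunE mulr_sumr.
  rewrite exchange_big; apply: eq_bigr => i /eqP <-.
  by rewrite -Lw LE.
have gE : g = eigen_comb S e (fun=> 1).
  apply/ffunP => x; rewrite ffunE gw [RHS]big_filter [RHS]big_mkcond /=.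
  under [RHS]eq_bigr => l _.
    have -> : (if e l != [ffun=> 0] then 1 * e l x else 0) = e l x.
      by case: eqP => [->|]; rewrite ?ffunE // mul1r.
    rewrite ffunE; over.
  rewrite (exchange_big_dep xpredT) //=; apply: eq_bigr => i _.
  rewrite -big_filter.
  have -> : [seq l <- undup [seq d i | i <- enum 'I_n] | d i == l] = [:: d i].
    apply: perm_small_eq => //; apply: uniq_perm => // [|l].
      by rewrite filter_uniq ?undup_uniq.
    rewrite mem_filter mem_undup inE eq_sym.
    by case: eqP => // ->; rewrite map_f // mem_enum.
  by rewrite big_seq1.
have dot_eg l f : (forall x, L f x = l * f x) ->
    dotW f g = if l \in S then dotW f (e l) else 0.
  move=> Lf; rewrite gE dotWC dotW_eigen_comb.
  under eq_bigr do rewrite mul1r.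
  case: ifPn => lS; last first.
    rewrite big_seq big1 // => m mS; apply: (eigen_orthogonal (l := m) (m := l)) => //.
    by apply: contraNneq lS => <-.
  rewrite (bigD1_seq _ lS Suniq) big1 => [|m ml]; first by rewrite [LHS]addr0 dotWC.
  exact: (eigen_orthogonal (l := m) (m := l)).
exists S, e; split => //.
  move=> l lS; rewrite (dot_eg l) // lS; apply: dotW_gt0.
  by move: lS; rewrite mem_filter => /andP[].
apply/seteqP; split => l /=.
  move=> lS; exists (e l) => //; rewrite (dot_eg l) // lS gt_eqF //.
  by apply: dotW_gt0; move: lS; rewrite mem_filter => /andP[].
by case=> f Lf; rewrite (dot_eg l) //; case: ifP => //; rewrite eqxx.
Qed.

End SelfAdjoint.

(** * Moments of a finite measure *)

Section Moments.
Context (R : realType).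
Implicit Types (S : seq R) (a : R -> R) (q : {poly R}).

(* With [a l = <e_l, 1>], the [k]-th moment of the measure putting mass [a l] at
   [1 / l], that is [<1, Delta^-k 1>]. *)
Definition spectral_moment S a (k : nat) : R := \sum_(l <- S) a l * l^-1 ^+ k.

Lemma sum_horner_moment S a q n :
  \sum_(l <- S) a l * l^-1 ^+ n * q.[l^-1] =
  \sum_(i < size q) q`_i * spectral_moment S a (i + n).
Proof.
under eq_bigr do rewrite horner_coef mulr_sumr.
rewrite exchange_big; apply: eq_bigr => i _; rewrite mulr_sumr.
by apply: eq_bigr => l _; rewrite exprD; ring.
Qed.

(** If [l] were missing from [S'], a polynomial vanishing at the inverses of all other points of
    both supports would integrate to 0 against the second measure but not against the first. *)
Lemma moments_sub_support S S' a a' :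
  uniq S -> (forall l, l \in S -> 0 < l) -> (forall l, l \in S -> 0 < a l) ->
  (forall k, spectral_moment S a k.+1 = spectral_moment S' a' k.+1) ->
  {subset S <= S'}.
Proof.
move=> Su S_gt0 a_gt0 mE l lS; apply: contraT => lS'.
pose r := rem l S ++ S'; pose q : {poly R} := \prod_(m <- r) ('X - m^-1%:P).
have q0 m : m \in r -> q.[m^-1] = 0.
  by move=> mr; rewrite horner_prod (big_rem m) //= hornerXsubC subrr mul0r.
have ql : q.[l^-1] != 0.
  rewrite horner_prod prodf_seq_neq0; apply/allP => m mr /=.
  rewrite hornerXsubC subr_eq0 (inj_eq invr_inj); apply: contraTneq mr => <-.
  by rewrite mem_cat (negPf lS') orbF mem_rem_uniqF.
(* The exponent 1 restricts the comparison to moments of positive order, the only ones assumed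
   equal. *)
have : \sum_(m <- S) a m * m^-1 ^+ 1 * q.[m^-1] =
       \sum_(m <- S') a' m * m^-1 ^+ 1 * q.[m^-1].
  by rewrite !sum_horner_moment; apply: eq_bigr => i _; rewrite addn1 mE.
rewrite [RHS]big_seq [RHS]big1 => [|m mS']; last first.
  by rewrite q0 ?mulr0 // mem_cat mS' orbT.
rewrite (big_rem l) //= big_seq big1 => [|m mS]; last first.
  by rewrite q0 ?mulr0 // mem_cat mS.
by move/eqP; rewrite addr0 !mulf_eq0 invr_eq0 (negPf ql) !gt_eqF ?a_gt0 ?S_gt0.
Qed.

Lemma moments_support_inj S S' a a' :
  uniq S -> (forall l, l \in S -> 0 < l) -> (forall l, l \in S -> 0 < a l) ->
  uniq S' -> (forall l, l \in S' -> 0 < l) -> (forall l, l \in S' -> 0 < a' l) ->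
  (forall k, spectral_moment S a k.+1 = spectral_moment S' a' k.+1) ->
  [set` S] = [set` S'].
Proof.
move=> Su Sp ap Su' Sp' ap' mE; apply/seteqP; split.
  exact: moments_sub_support mE.
by apply: (@moments_sub_support S' S a' a) => // k; rewrite mE.
Qed.

(* The columns are reversed so that the solution lists the coefficients of the
   polynomial with roots [l] rather than [1 / l]. *)
Definition hankel (A : nmodType) N (m : nat -> A) : 'M[A]_N :=
  \matrix_(j, i) m (N - i + j)%N.

(** A vector in the left kernel is a polynomial [q] of degree below the number N of atoms,
    orthogonal to x, ..., x^N and hence to x q(x). Then sum_l a_l l^-1 q(1/l)^2 = 0 forces [q] to
    vanish at N distinct points. *)
Lemma hankel_unit S a : uniq S ->
  (forall l, l \in S -> 0 < l) -> (forall l, l \in S -> 0 < a l) ->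
  hankel (size S) (spectral_moment S a) \in unitmx.
Proof.
move=> Su S_gt0 a_gt0; rewrite -row_free_unit; apply: inj_row_free => v vM.
pose q : {poly R} := rVpoly v.
have size_q : (size q <= size S)%N by exact: size_poly.
have qM n : (0 < n <= size S)%N -> \sum_(l <- S) a l * l^-1 ^+ n * q.[l^-1] = 0.
  move=> /andP[n0 nS]; rewrite sum_horner_moment.
  have iS : (size S - n < size S)%N by rewrite ltn_subrL n0 (leq_trans n0).
  have := congr1 (fun w : 'rV_ _ => w 0 (Ordinal iS)) vM; rewrite !mxE => vMi.
  rewrite (big_ord_widen (size S) (fun i => q`_i * spectral_moment S a (i + n))) //.
  rewrite -[RHS]vMi [in LHS]big_mkcond; apply: eq_bigr => j _.
  rewrite !mxE /= subKn // addnC -coef_rVpoly_ord -/q.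
  by case: ltnP => // /(nth_default 0) ->; rewrite mul0r.
have q2 : \sum_(l <- S) a l * l^-1 * q.[l^-1] ^+ 2 = 0.
  transitivity (\sum_(l <- S) \sum_(i < size q) q`_i * (a l * l^-1 ^+ i.+1 * q.[l^-1])).
    apply: eq_bigr => l _; rewrite expr2 {1}horner_coef mulr_suml mulr_sumr.
    by apply: eq_bigr => i _; rewrite exprS; ring.
  rewrite exchange_big big1 // => i _; rewrite -mulr_sumr qM ?mulr0 //=.
  exact: leq_trans size_q.
have q_root l : l \in S -> q.[l^-1] = 0.
  have t_ge0 m : m \in S -> 0 <= a m * m^-1 * q.[m^-1] ^+ 2.
    move=> mS; apply: mulr_ge0 (sqr_ge0 _); apply: mulr_ge0.
      exact/ltW/a_gt0.
    by rewrite invr_ge0 ltW // S_gt0.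
  move=> lS; apply/eqP; move: q2 => /eqP; rewrite (big_rem l) //= paddr_eq0 ?t_ge0 //.
    move=> /andP[+ _]; rewrite !mulf_eq0 invr_eq0 (gt_eqF (a_gt0 _ lS)).
    by rewrite (gt_eqF (S_gt0 _ lS)) /= orbb.
  by rewrite big_seq sumr_ge0 // => m /mem_rem; exact: t_ge0.
suff q_eq0 : q = 0 by rewrite -[v](rVpolyK) -/q q_eq0 linear0.
apply: (@roots_geq_poly_eq0 _ _ [seq l^-1 | l <- S]).
- by apply/allP => _ /mapP[l lS ->]; apply/rootP/q_root.
- by rewrite map_inj_uniq //; exact: invr_inj.
- by rewrite size_map.
Qed.

(** With N the size of [S], multiply P(l) = 0 by a_l l^-(N+j). As [P] is monic, the leading term is
    a_l l^-j, and summing over [S] gives row [j]. *)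
Lemma char_coef_moment S a (P := \prod_(l <- S) ('X - l%:P)) :
  (forall l, l \in S -> 0 < l) ->
  hankel (size S) (spectral_moment S a) *m (\col_(i < size S) P`_i) =
  - \col_(j < size S) spectral_moment S a j.
Proof.
move=> S_gt0; apply/colP => j; rewrite !mxE.
under eq_bigr do rewrite !mxE mulr_suml.
rewrite exchange_big /= /spectral_moment -sumrN; apply: eq_big_seq => l lS.
have l0 : l != 0 by rewrite gt_eqF ?S_gt0.
have Pl : P.[l] = 0.
  by rewrite horner_prod (big_rem l) //= hornerXsubC subrr mul0r.
have sP : size P = (size S).+1 by rewrite size_prod_XsubC.
have P1 : P`_(size S) = 1.
  have /monicP := monic_prod_XsubC S xpredT id.
  by rewrite lead_coefE -/P sP.
apply/eqP; rewrite eq_sym -subr_eq0 -opprD oppr_eq0; apply/eqP.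
transitivity (a l * l^-1 ^+ (size S + j) * P.[l]); last by rewrite Pl mulr0.
rewrite horner_coef sP big_ord_recr /= P1 mulrDr addrC; congr (_ + _).
  rewrite mulr_sumr; apply: eq_bigr => i _.
  have E : l^-1 ^+ (size S + j) * l ^+ i = l^-1 ^+ (size S - i + j).
    have -> : (size S + j = size S - i + j + i)%N.
      by rewrite addnAC subnK // ltnW.
    by rewrite exprD -mulrA -exprMn mulVf ?expr1n ?mulr1.
  by rewrite -E; ring.
by rewrite addnC exprD mul1r -!mulrA -exprMn mulVf // expr1n mulr1.
Qed.

(* Cramer's rule for the Hankel system of [char_coef_moment]. *)
Lemma moment_ratfun N (b : nat -> nat -> R) :
  exists f : 'I_N -> ratfun R (2 * N),
    forall (A : nat -> \bar R) (m : nat -> R) S a,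
      uniq S -> size S = N ->
      (forall l, l \in S -> 0 < l) -> (forall l, l \in S -> 0 < a l) ->
      (forall j, (j < 2 * N)%N -> A j = (m j)%:E) ->
      (forall k, (k < 2 * N)%N ->
         spectral_moment S a k = \sum_(j < 2 * N) b k j * m j) ->
      recovers f A [set` S].
Proof.
pose mon (j : 'I_(2 * N)) : mpoly.mpoly (2 * N) R := mpoly.mpolyX R (mpoly.mnm1 j).
(* [gen k] is the [k]-th spectral moment written as a linear form in the 2N variables. *)
pose gen k : mpoly.mpoly (2 * N) R := \sum_(j < 2 * N) b k j *: mon j.
pose den := \det (hankel N gen).
pose num := - (\adj (hankel N gen) *m \col_(j < N) gen j).
exists (fun i => FracField.tofrac (num i 0) / FracField.tofrac den).
move=> A m S a Su SN S_gt0 a_gt0 Am mE.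
pose v (j : 'I_(2 * N)) := m j.
pose ev : {rmorphism mpoly.mpoly (2 * N) R -> R} := mpoly.meval v.
have ev_gen k : (k < 2 * N)%N -> ev (gen k) = spectral_moment S a k.
  move=> kN; rewrite mE // rmorph_sum; apply: eq_bigr => j _.
  by rewrite /= mpoly.mevalZ mpoly.mevalXU.
have evH : map_mx ev (hankel N gen) = hankel N (spectral_moment S a).
  by apply/matrixP => j i; rewrite !mxE ev_gen //; move: (ltn_ord j); lia.
have evc : map_mx ev (\col_(j < N) gen j) = \col_(j < N) spectral_moment S a j.
  by apply/colP => j; rewrite !mxE ev_gen //; move: (ltn_ord j); lia.
have Hunit : hankel N (spectral_moment S a) \in unitmx.
  by rewrite -SN hankel_unit.
have den0 : ev den != 0 by rewrite -det_map_mx evH -unitfE -unitmxE.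
pose P := \prod_(l <- S) ('X - l%:P).
have cE : \col_(i < N) P`_i = (ev den)^-1 *: map_mx ev num.
  apply: (can_inj (mulKmx Hunit)).
  have := char_coef_moment a S_gt0; rewrite SN => ->.
  rewrite map_mxN map_mxM map_mx_adj evH evc -scalemxAr mulmxN mulmxA mul_mx_adj.
  by rewrite mul_scalar_mx scalerN -det_map_mx evH scalerA mulVf ?scale1r // -evH det_map_mx.
exists v, (fun i : 'I_N => P`_i); split => [j|i|].
- exact: Am.
- exists (num i 0), den; split=> //.
  have := congr1 (fun w : 'cV_N => w i 0) cE; rewrite !mxE => ->.
  by rewrite mulrC.
- have -> : 'X^N + \sum_(i < N) P`_i *: 'X^i = P.
    have sP : size P = N.+1 by rewrite size_prod_XsubC SN.
    have PN : P`_N = 1.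
      by have /monicP := monic_prod_XsubC S xpredT id; rewrite lead_coefE -/P sP.
    apply/polyP => k; rewrite -poly_def coefD coefXn coef_poly.
    case: (ltngtP k N) => [_|Nk|->]; rewrite ?add0r ?addr0 //.
    by rewrite nth_default // sP.
  apply/seteqP; split => x /=; rewrite /P root_prod_XsubC //.
Qed.

End Moments.

(** * The Dirichlet form of a domain *)

Section DirichletForm.
Context (R : realType) (V : choiceType) (G : graph_with_geometry R V)
  (D : finite_subgraph G).
Local Notation mV := (WV (gweight G)).
Local Notation mE := (WE (gweight G)).
Local Notation iD := (interior_verts D).
Local Notation W := (fun x : iD => mV (val x)).
Implicit Types (f : {ffun iD -> R}) (x y : iD).

Definition laplace_coef x y : R :=
  (x == y)%:R * wV G (val x) - mE (val x) (val y).

Lemma laplaceE f x : laplace f x = \sum_y laplace_coef x y * f y.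
Proof.
rewrite ffunE; under [RHS]eq_bigr do rewrite mulrBl.
rewrite sumrB; congr (_ - _).
rewrite (bigD1 x) //= eqxx mul1r big1 ?addr0 // => y yx.
by rewrite eq_sym (negPf yx) !mul0r.
Qed.

Lemma laplace_coef_sym x y :
  laplace_coef x y * mV (val x) = laplace_coef y x * mV (val y).
Proof.
rewrite !mulrBl WE_WV; congr (_ - _); rewrite [y == x]eq_sym.
by have [->|_] := eqVneq x y; rewrite ?mul0r.
Qed.

Lemma WE_eq0 (v w : V) : ~~ G v w -> mE v w = 0.
Proof.
by rewrite -(WE_gt0 (gweight G)) lt0r WE_ge0 andbT negbK => /eqP.
Qed.

(** The edge weight from [v] to the complement of [iD] (see [leakE]): the killing term of the
    Dirichlet form. *)
Definition leak (v : V) : R := wV G v - \sum_(y : iD) mE v (val y).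

Lemma leakE v :
  leak v = \sum_(w <- fset_set [set w | G v w] | w \notin iD) mE v w.
Proof.
rewrite /leak /wV fsbig_finite /=; last exact: edge_fin.
set N := fset_set _; have inN w : w \in N = G v w.
  by rewrite in_fset_set; [apply/idP/idP; rewrite inE | exact: edge_fin].
rewrite (bigID (fun w => w \in iD)) /=.
suff -> : \sum_(y : iD) mE v (val y) = \sum_(w <- N | w \in iD) mE v w.
  by rewrite addrAC subrr add0r.
rewrite -(big_seq_fsetE _ _ predT (fun w => mE v w)) /=.
rewrite (bigID (fun w => w \in N)) /= [X in _ + X]big1 ?addr0 => [|w]; last first.
  by rewrite inN; exact: WE_eq0.
rewrite -[LHS]big_filter -[RHS]big_filter; apply: perm_big.
apply: uniq_perm; rewrite ?filter_uniq ?fset_uniq // => w.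
by rewrite !mem_filter andbC.
Qed.

Lemma leak_ge0 v : 0 <= leak v.
Proof. by rewrite leakE sumr_ge0 // => w _; exact: WE_ge0. Qed.

Lemma leak_gt0 v w : G v w -> w \notin iD -> 0 < leak v.
Proof.
move=> vw wD; rewrite leakE (big_rem w) /=; last first.
  by rewrite in_fset_set; [rewrite inE | exact: edge_fin].
by rewrite wD ltr_pwDl ?WE_gt0 // sumr_ge0 // => z _; exact: WE_ge0.
Qed.

(** A walk in [D] from [x] to a boundary vertex has a first vertex outside [iD]. The interior vertex
    just before it has positive [leak], and the property travels back along the walk. *)
Lemma leak_ind (Z : iD -> Prop) :
  is_domain D -> boundary_verts D != fset0 ->
  (forall x, 0 < leak (val x) -> Z x) ->
  (forall x y, G (val x) (val y) -> Z y -> Z x) ->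
  forall x, Z x.
Proof.
move=> [Dconn _] /fset0Pn[z]; rewrite inE => /andP[zD zV] Zleak Zedge x.
have xV : val x \in sverts D by have := valP x; rewrite inE => /andP[].
have [p xp pz] := Dconn _ _ xV zV; elim: p x {xV} xp pz => [|v p IH] x /=.
  by move=> _ xz; move: zD; rewrite -xz (valP x).
move=> /andP[xv vp] pz; have [xvG _ _] := sedge_sub xv.
have [vD|vD] := boolP (v \in iD); last exact/Zleak/(leak_gt0 xvG).
by apply: (Zedge _ [` vD]%fset) => //; apply: IH.
Qed.

(* [b = false] is Green's formula for the Laplacian; [b = true] is its
   counterpart for the signless Laplacian [2 wV - Delta]. *)
Lemma dirichlet_form (b : bool) f :
  dotW W f [ffun x => wV G (val x) * f x
                      - (-1) ^+ b * \sum_y mE (val x) (val y) * f y] =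
  2^-1 * (\sum_x \sum_y mE (val x) (val y) * mV (val x)
            * (f x - (-1) ^+ b * f y) ^+ 2)
  + \sum_x leak (val x) * f x ^+ 2 * mV (val x).
Proof.
pose c x y := mE (val x) (val y) * mV (val x).
have c_sym x y : c x y = c y x by exact: WE_WV.
(* When the square is expanded, the two diagonal sums agree by symmetry of [c], whence the factors
   2. *)
have -> : \sum_x \sum_y c x y * (f x - (-1) ^+ b * f y) ^+ 2 =
    2 * (\sum_x \sum_y c x y * f x ^+ 2)
    - 2 * (\sum_x \sum_y c x y * ((-1) ^+ b * (f x * f y))).
  have E x y : c x y * (f x - (-1) ^+ b * f y) ^+ 2 =
      c x y * f x ^+ 2 + c x y * f y ^+ 2
      - 2 * (c x y * ((-1) ^+ b * (f x * f y))).
    by case: b; ring.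
  under eq_bigr do under eq_bigr do rewrite E.
  under eq_bigr do rewrite sumrB big_split -mulr_sumr.
  rewrite sumrB big_split -mulr_sumr; congr (_ - _).
  rewrite /= mulr_natl mulr2n; congr (_ + _); rewrite exchange_big.
  by apply: eq_bigr => x _; apply: eq_bigr => y _; rewrite c_sym.
rewrite mulrBr !mulKf // addrAC -big_split -sumrB; apply: eq_bigr => x _ /=.
rewrite ffunE /leak /c; set s := \sum_y mE _ _; set t := \sum_y mE _ _ * f y.
have -> : \sum_(y : iD) mE (fsval x) (fsval y) * mV (fsval x) * f x ^+ 2
    = s * mV (fsval x) * f x ^+ 2.
  by rewrite /s !mulr_suml.
have -> : \sum_(y : iD) mE (fsval x) (fsval y) * mV (fsval x) * ((-1) ^+ b * (f x * f y))
    = (-1) ^+ b * f x * mV (fsval x) * t.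
  by rewrite /t mulr_sumr; apply: eq_bigr => y _; ring.
by ring.
Qed.

(** If the form vanishes, [f] is zero wherever [leak] is positive, and the equality of f(x) and f(y)
    up to sign along edges carries the zeros to all of [iD] by [leak_ind]. *)
Lemma dirichlet_form_gt0 (b : bool) f :
  is_domain D -> boundary_verts D != fset0 -> f != [ffun=> 0] ->
  0 < dotW W f [ffun x => wV G (val x) * f x
                      - (-1) ^+ b * \sum_y mE (val x) (val y) * f y].
Proof.
move=> Ddom Dbd f0; rewrite dirichlet_form.
have mV_ge0 v : 0 <= mV v by apply/ltW/WV_gt0.
have c_ge0 x y : 0 <= mE (val x) (val y) * mV (val x)
    * (f x - (-1) ^+ b * f y) ^+ 2.
  by apply: mulr_ge0 (sqr_ge0 _); apply: mulr_ge0 => //; exact: WE_ge0.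
have l_ge0 x : 0 <= leak (val x) * f x ^+ 2 * mV (val x).
  apply: mulr_ge0 => //; apply: mulr_ge0 (sqr_ge0 _); exact: leak_ge0.
have sc_ge0 x : 0 <= \sum_y mE (val x) (val y) * mV (val x)
    * (f x - (-1) ^+ b * f y) ^+ 2 by apply: sumr_ge0.
rewrite lt0r addr_ge0 ?mulr_ge0 ?sumr_ge0 ?invr_ge0 // andbT.
apply: contra f0; rewrite paddr_eq0 ?mulr_ge0 ?sumr_ge0 ?invr_ge0 //.
rewrite mulf_eq0 invr_eq0 pnatr_eq0 /= => /andP[/eqP cE /eqP lE].
apply/eqP/ffunP => x; rewrite ffunE; move: x.
apply: (leak_ind Ddom Dbd) => [x x0|x y xy y0].
  have /eqP := (psumr_eq0P (fun x _ => l_ge0 x) lE) x isT.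
  by rewrite !mulf_eq0 (gt_eqF x0) (gt_eqF (WV_gt0 _ _)) orbF /= orbb => /eqP.
have := (psumr_eq0P (fun x _ => sc_ge0 x) cE) x isT.
move=> /(psumr_eq0P (fun y _ => c_ge0 x y))/(_ y isT)/eqP.
rewrite y0 mulr0 subr0 !mulf_eq0 (gt_eqF (WV_gt0 _ _)).
by rewrite gt_eqF ?WE_gt0 // /= orbb => /eqP.
Qed.

Lemma laplace_eigen_gt0 l f :
  is_domain D -> boundary_verts D != fset0 -> f != [ffun=> 0] ->
  (forall x, laplace f x = l * f x) -> 0 < l.
Proof.
move=> Ddom Dbd f0 Lf; have := dirichlet_form_gt0 false Ddom Dbd f0.
rewrite (_ : [ffun x => _] = [ffun x => l * f x]); last first.
  by apply/ffunP => x; rewrite !ffunE -Lf ffunE mul1r.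
by rewrite dotWZr pmulr_lgt0 // dotW_gt0 // => x; exact: WV_gt0.
Qed.

(** On a regular domain the signless Laplacian is 2 alpha - Delta, and it is positive definite.
    Together with 0 < l the bound gives |1 - l / alpha| < 1, which makes the exit time series
    converge. *)
Lemma laplace_eigen_lt (alpha l : R) f :
  is_domain D -> boundary_verts D != fset0 -> weight_regular D alpha ->
  f != [ffun=> 0] -> (forall x, laplace f x = l * f x) -> l < 2 * alpha.
Proof.
move=> Ddom Dbd reg f0 Lf; have := dirichlet_form_gt0 true Ddom Dbd f0.
rewrite (_ : [ffun x => _] = [ffun x => (2 * alpha - l) * f x]); last first.
  apply/ffunP => x; rewrite !ffunE mulrBl -Lf ffunE reg ?(valP x) // expr1.
  by ring.
by rewrite dotWZr pmulr_lgt0 ?subr_gt0 // dotW_gt0 // => x; exact: WV_gt0.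
Qed.

Lemma innerE f g : inner f g = dotW W f g.
Proof. by []. Qed.

Definition spectral_data (S : seq R) (e : R -> {ffun iD -> R}) : Prop :=
  [/\ uniq S,
      forall l, l \in S -> forall x, laplace (e l) x = l * e l x,
      forall l, l \in S -> 0 < dotW W (e l) (one_iD D),
      one_iD D = eigen_comb S e (fun=> 1)
    & [set` S] = spec_star D].

Lemma spectral_data_exists : exists S e, spectral_data S e.
Proof.
have [S [e [Su Le ae oneE SE]]] := spectral_resolution
  (fun x : iD => WV_gt0 (gweight G) (val x)) laplace_coef_sym laplaceE (one_iD D).
exists S, e; split=> //; rewrite SE; apply/seteqP; split => l /=.
  by case=> f Lf f1; exists f.
by case=> f [Lf f1]; exists f.
Qed.

Lemma spectral_data_neq0 S e l : spectral_data S e -> l \in S ->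
  e l != [ffun=> 0].
Proof.
case=> _ _ ae _ _ lS; apply: contraTneq (ae _ lS) => ->.
by rewrite -leNgt /dotW big1 // => x _; rewrite ffunE !mul0r.
Qed.

(** With g = Delta^-k 1 one has <f, 1> = <f, Delta^k g>, so Cauchy-Schwarz bounds each quotient by
    <g, Delta^k g> = <g, 1> = m_k, with equality at f = g. *)
Lemma A2E S e k :
  is_domain D -> boundary_verts D != fset0 -> spectral_data S e ->
  A2 D k = (k`!%:R *
    spectral_moment S (fun l => dotW W (e l) (one_iD D)) k)%:E.
Proof.
move=> Ddom Dbd Se; have [Su Le ae oneE _] := Se.
have S_gt0 l : l \in S -> 0 < l.
  by move=> lS; apply: laplace_eigen_gt0 (spectral_data_neq0 Se lS) (Le _ lS).
set m := spectral_moment _ _ _.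
have W_gt0 (x : iD) : 0 < mV (val x) by exact: WV_gt0.
have L_ge0 f : 0 <= dotW W f (laplace f).
  have [->|f0] := eqVneq f [ffun=> 0].
    by rewrite /dotW big1 // => x _; rewrite ffunE !mul0r.
  have := ltW (dirichlet_form_gt0 false Ddom Dbd f0).
  by rewrite expr0; congr (0 <= dotW _ _ _); apply/ffunP => x; rewrite !ffunE mul1r.
pose g := eigen_comb S e (fun l => l^-1 ^+ k).
have Lg : iter k (@laplace _ _ G D) g = one_iD D.
  rewrite (iter_eigen_comb laplaceE) // oneE.
  apply/ffunP => x; rewrite !ffunE; apply: eq_big_seq => l lS.
  by rewrite -exprMn mulVf ?expr1n // gt_eqF ?S_gt0.
have g1 : dotW W g (one_iD D) = m.
  by rewrite dotW_eigen_comb; apply: eq_bigr => l _; rewrite mulrC.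
have one_neq0 : one_iD D != [ffun=> 0].
  have [_ /fset0Pn[z zD]] := Ddom; apply/eqP => /ffunP/(_ [` zD]%fset)/eqP.
  by rewrite !ffunE oner_eq0.
have S_neq0 : S != [::].
  apply: contraNneq one_neq0 => S0; rewrite oneE S0.
  by apply/eqP/ffunP => x; rewrite !ffunE big_nil.
have m_gt0 : 0 < m.
  have t_gt0 l : l \in S -> 0 < dotW W (e l) (one_iD D) * l^-1 ^+ k.
    by move=> lS; rewrite mulr_gt0 ?ae // exprn_gt0 // invr_gt0 S_gt0.
  exact: sumr_seq_gt0.
have Bg : dotW W g (iter k (@laplace _ _ G D) g) = m by rewrite Lg.
rewrite /A2 EFinM; congr (_ * _)%E; apply/eqP; rewrite eq_le; apply/andP; split.
  apply: ub_ereal_sup => _ [f _ <-]; rewrite lee_fin /A2_quotient !innerE.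
  have := dotW_cauchy_schwarz W_gt0 laplace_coef_sym laplaceE (k := k) f (g := g).
  rewrite Bg Lg => /(_ L_ge0 m_gt0) cs.
  have B_ge0 := dotW_iter_ge0 W_gt0 laplace_coef_sym laplaceE k f L_ge0.
  rewrite ger0_norm //; move: B_ge0; rewrite le_eqVlt => /orP[/eqP B0|B_gt0].
    (* Division by 0 gives 0, so here the quotient is 0, below the positive bound [m]. *)
    by rewrite -B0 invr0 mulr0 ltW.
  by rewrite ler_pdivrMr // mulrC.
apply: ereal_sup_ubound; exists g => /=; last first.
  congr EFin; rewrite /A2_quotient !innerE Bg g1 gtr0_norm //.
  by rewrite expr2 mulfK // gt_eqF.
apply: contraTneq m_gt0 => g0; rewrite -g1 g0 -leNgt /dotW big1 // => x _.
by rewrite ffunE !mul0r.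
Qed.

End DirichletForm.

(** * Moments of the geometric law *)

Section GeometricMoments.
Context (R : realType).
Implicit Types (r : R) (k : nat).

(** The terms of the power series of (1 - r)^-(k+1). *)
Definition negbin k r : R^nat := fun n => 'C(n + k, k)%:R * r ^+ n.

(* Pascal's rule, summed by parts. *)
Lemma series_negbinS k r n :
  (1 - r) * series (negbin k.+1 r) n =
  series (negbin k r) n - 'C(n + k, k.+1)%:R * r ^+ n.
Proof.
elim: n => [|n IH].
  by rewrite /series /= !big_geq // bin_small ?add0n // !mul0r mulr0 subr0.
rewrite !seriesSr mulrDr {}IH /negbin addSn !addnS binS natrD exprS.
by rewrite [in RHS]addrC -!addrA; ring.
Qed.

Lemma is_cvg_series_negbin k r : 0 <= r < 1 -> cvgn (series (negbin k r)).
Proof.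
move=> /andP[r0 r1]; have ge0 j n : 0 <= negbin j r n.
  by rewrite mulr_ge0 // exprn_ge0.
have nd j : nondecreasing_seq (series (negbin j r)).
  by apply/nondecreasing_seqP => n; rewrite seriesSr lerDl.
elim: k => [|k IH].
  have -> : negbin 0 r = geometric 1 r.
    by apply/funext => n; rewrite /negbin bin0.
  by apply: is_cvg_geometric_series; rewrite ger0_norm.
apply: nondecreasing_is_cvgn => //.
exists (limn (series (negbin k r)) / (1 - r)) => _ [n _ <-].
rewrite ler_pdivlMr ?subr_gt0 // mulrC series_negbinS.
apply: le_trans (nondecreasing_cvgn_le (nd k) IH n).
by rewrite lerBlDr lerDl mulr_ge0 // exprn_ge0.
Qed.

(** Passing to the limit in [series_negbinS] contributes one factor 1 / (1 - r) per step. The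
    correction there is dominated by a term of [negbin k.+1 r], which tends to 0 by absolute
    convergence. *)
Lemma cvg_series_negbin k r : `|r| < 1 ->
  series (negbin k r) @ \oo --> (1 - r)^-1 ^+ k.+1.
Proof.
move=> r1; have r1' : 1 - r != 0.
  by rewrite subr_eq0 gt_eqF // (le_lt_trans (ler_norm r)).
have norm_cvg0 j : negbin j r @ \oo --> (0 : R).
  apply/norm_cvg0P; apply: cvg_series_cvg_0.
  have := @is_cvg_series_negbin j `|r|; rewrite normr_ge0 r1 => /(_ isT).
  by congr (cvgn (series _)); apply/funext => n /=; rewrite normrM normrX normr_nat.
elim: k => [|k IH].
  have -> : negbin 0 r = geometric 1 r.
    by apply/funext => n; rewrite /negbin bin0.
  by rewrite expr1 -[_^-1]mul1r; exact: cvg_geometric_series.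
have -> : series (negbin k.+1 r) = fun n => (1 - r)^-1 *
    (series (negbin k r) n - 'C(n + k, k.+1)%:R * r ^+ n).
  by apply/funext => n; rewrite -series_negbinS mulKf.
rewrite exprS -[X in _ * X]subr0; apply: cvgMr; apply: cvgB => //.
apply/norm_cvg0P; apply: (squeeze_cvgr _ (cvg_cst 0)); last first.
  by apply/norm_cvg0P; exact: (norm_cvg0 k.+1).
near=> n; rewrite normr_ge0 /= /negbin !normrM !normr_nat ler_wpM2r //.
by rewrite ler_nat leq_bin2l // addnS.
Unshelve. all: by end_near. Qed.

Definition rising_poly k : {poly R} := \prod_(i < k) ('X + i%:R%:P).

Lemma horner_rising_polyS k n :
  (rising_poly k.+1).[n%:R] = (k.+1`! * 'C(n + k, k.+1))%:R.
Proof.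
elim: k => [|k IH].
  by rewrite /rising_poly big_ord1 addr0 hornerX bin1 addn0 mul1n.
rewrite /rising_poly big_ord_recr -/(rising_poly k.+1) hornerM IH.
rewrite hornerD hornerX hornerC -natrD -natrM; congr _%:R.
have /= E := mul_bin_diag (n + k).+1 k.+1.
rewrite addnS [in RHS]factS -[RHS]mulnA [RHS]mulnCA -E -[LHS]mulnA.
by congr (_ * _)%N; exact: mulnC.
Qed.

Lemma coef0_rising_polyS k : (rising_poly k.+1)`_0 = 0.
Proof. by rewrite -horner_coef0 -[0]/(0%:R) horner_rising_polyS bin_small ?muln0. Qed.

Lemma size_rising_poly k : size (rising_poly k) = k.+1.
Proof.
rewrite /rising_poly -(big_mkord xpredT (fun i => 'X + i%:R%:P)).
under eq_bigr do rewrite -[_%:P]opprK -polyCN.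
by rewrite size_prod_XsubC size_iota subn0.
Qed.

(** Summation by parts: for k > 0 and P(eta > n) = r^n these are the terms of E(eta^k). They all
    vanish for k = 0, and they make sense for negative [r] too. *)
Definition geom_diff k r : R^nat := fun n => (n.+1%:R ^+ k - n%:R ^+ k) * r ^+ n.

(** Since (n+1)^k <= k! C(n+k, k), a negative binomial series dominates. *)
Lemma is_cvg_series_geom_diff k r : `|r| < 1 -> cvgn (series (geom_diff k r)).
Proof.
move=> r1; have pow_bin n : (n.+1 ^ k <= k`! * 'C(n + k, k))%N.
  elim: k => [|j IH]; first by rewrite bin0.
  rewrite expnSr factS addnS.
  have /= E := mul_bin_diag (n + j).+1 j.
  rewrite -[leqRHS]mulnA [leqRHS]mulnCA -E mulnCA mulnC.
  by rewrite leq_mul // ltnS leq_addr.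
apply: normed_cvg; apply: (@series_le_cvg _ _ (fun n => k`!%:R * negbin k `|r| n)).
- by move=> n; rewrite normr_ge0.
- by move=> n; rewrite !mulr_ge0 // exprn_ge0.
- move=> n /=; rewrite /geom_diff normrM normrX mulrA -natrM ler_wpM2r ?exprn_ge0 //.
  rewrite ger0_norm; last by rewrite subr_ge0 lerXn2r ?nnegrE // ler_nat.
  by rewrite lerBlDr -!natrX -natrD ler_nat (leq_trans (pow_bin n)) // leq_addr.
- have := @is_cvg_series_negbin k `|r|; rewrite normr_ge0 r1 => /(_ isT).
  exact: is_cvg_seriesZ.
Qed.

Definition geom_moment k r : R := limn (series (geom_diff k r)).

(** By Pascal's rule the rising factorial c satisfies c(n+1) - c(n) = (k+1)! C(n+k, k), which turns
    the sum into a negative binomial series. *)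
Lemma sum_geom_moment k r : `|r| < 1 ->
  \sum_(j < k.+2) (rising_poly k.+1)`_j * geom_moment j r =
  k.+1`!%:R * (1 - r)^-1 ^+ k.+1.
Proof.
move=> r1; set c := rising_poly k.+1.
have lhs : (fun n => \sum_(j < k.+2) c`_j * series (geom_diff j r) n) @ \oo -->
    \sum_(j < k.+2) c`_j * geom_moment j r.
  apply: cvg_big => [|j _]; first exact: add_continuous.
  by apply: cvgMr; exact: is_cvg_series_geom_diff.
rewrite -(cvg_lim _ lhs) //; apply: cvg_lim => //.
rewrite (_ : (fun n => _) = fun n => k.+1`!%:R * series (negbin k r) n).
  by apply: cvgMr; exact: cvg_series_negbin.
apply/funext => n; rewrite /series /= mulr_sumr.
under eq_bigr do rewrite mulr_sumr.
rewrite exchange_big; apply: eq_bigr => i _ /=.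
have horner_c m : c.[m%:R] = \sum_(j < k.+2) c`_j * m%:R ^+ j.
  by rewrite horner_coef size_rising_poly.
transitivity ((c.[i.+1%:R] - c.[i%:R]) * r ^+ i).
  rewrite !horner_c -sumrB mulr_suml; apply: eq_bigr => j _.
  by rewrite /geom_diff; ring.
rewrite !horner_rising_polyS addSn binS mulnDr natrD addrAC subrr add0r.
by rewrite /negbin natrM mulrA.
Qed.

End GeometricMoments.

(** * The exit time of the chain *)

Lemma nneseries_ge_cst (R : realType) (u : nat -> \bar R) (c : R) : 0 < c ->
  (forall n, (c%:E <= u n)%E) -> (\sum_(0 <= n <oo) u n = +oo)%E.
Proof.
move=> c0 cu; apply/eqyP => a a0.
have u0 n : (0 <= u n)%E by apply: le_trans (cu n); rewrite lee_fin ltW.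
apply: (@le_trans _ _ (\sum_(0 <= n < (Num.truncn (a / c)).+1) u n)%E); last first.
  exact: nneseries_lim_ge.
apply: (@le_trans _ _ (\sum_(0 <= n < (Num.truncn (a / c)).+1) c%:E)%E).
  rewrite sumEFin lee_fin sumr_const_nat subn0 -mulr_natl -ler_pdivrMr //.
  by rewrite ltW // truncnS_gt.
by apply: lee_sum => n _; exact: cu.
Qed.

Lemma nneseries_trunc (R : realType) (u : nat -> \bar R) h :
  (forall n, (0 <= u n)%E) -> (forall n, (h <= n)%N -> u n = 0%E) ->
  (\sum_(0 <= n <oo) u n = \sum_(0 <= n < h) u n)%E.
Proof.
move=> u0 uh; rewrite (nneseries_split 0 h) // add0n eseries0 ?adde0 //.
by move=> n hn _; exact: uh.
Qed.

Section ExitTime.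
Context (R : realType) (V : choiceType) (G : graph_with_geometry R V)
  (X : markov_chain G) (D : finite_subgraph G).
Local Notation iD := (interior_verts D).
Implicit Types (n m k : nat) (v : nat -> V) (w : mc_space X).

Definition stays n : set (mc_space X) :=
  [set w | forall i, (i <= n)%N -> proc i w \in iD].

Lemma staysS n m : (m <= n)%N -> stays n `<=` stays m.
Proof. by move=> mn w sw i im; apply: sw; exact: leq_trans mn. Qed.

Lemma measurable_stays n : measurable (stays n).
Proof.
have -> : stays n = \bigcap_(i in [set i | (i <= n)%N]) (proc i @^-1` [set x | x \in iD]).
  by apply/seteqP; split => w sw i; exact: sw.
by apply: bigcap_measurableType => i _; exact: proc_measurable.
Qed.

Lemma lt_exit_time n w : (n%:R%:E < exit_time D w)%E = `[< stays n w >].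
Proof.
apply/idP/asboolP => [nw i ni|sw].
  apply: contraTT nw => iD'; rewrite -leNgt; apply: (@le_trans _ _ i%:R%:E).
    by apply: ereal_inf_lbound; exists i.
  by rewrite lee_fin ler_nat.
apply: (@lt_le_trans _ _ n.+1%:R%:E); first by rewrite lte_fin ltr_nat.
apply/ereal_infP => _ [i iw <-]; rewrite lee_fin ler_nat ltnNge.
by apply: contra iw => ni; exact: sw.
Qed.

(** Here tau = eta / alpha, and eta^(k+1) telescopes over n < eta. Written with indicators, its
    expectation involves only the probabilities of the events [stays n]. *)
Lemma weighted_exit_time_exp (alpha : R) k w : 0 < alpha -> weight_regular D alpha ->
  (weighted_exit_time D w ^+ k.+1 =
   \sum_(0 <= n <oo) ((alpha^-1 ^+ k.+1 * (n.+1%:R ^+ k.+1 - n%:R ^+ k.+1))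
                      * \1_(stays n) w)%:E)%E.
Proof.
move=> a0 reg.
have -> : weighted_exit_time D w = (\sum_(0 <= n <oo) (alpha^-1 * \1_(stays n) w)%:E)%E.
  rewrite /weighted_exit_time eseries_mkcond; apply: eq_eseriesr => n _.
  rewrite lt_exit_time indicE; have [sw|sw] := pselect (stays n w).
    rewrite asboolT // mem_set // mulr1 reg //; exact: sw.
  by rewrite asboolF // memNset // mulr0.
have d_ge0 n : 0 <= (n.+1%:R ^+ k.+1 - n%:R ^+ k.+1 : R).
  by rewrite subr_ge0 lerXn2r ?nnegrE // ler_nat.
have c0 : 0 < alpha^-1 ^+ k.+1 by rewrite exprn_gt0 ?invr_gt0.
have [sw|/existsNP[h0 sh0]] := pselect (forall n, stays n w).
  have ind1 n : \1_(stays n) w = 1 :> R by rewrite indicE mem_set.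
  (* The trajectory never leaves [iD]: both series have terms bounded below by a positive constant,
     so both sides are infinite. *)
  rewrite (@nneseries_ge_cst _ _ alpha^-1); first last.
  - by move=> n; rewrite ind1 mulr1.
  - by rewrite invr_gt0.
  rewrite (@nneseries_ge_cst _ _ (alpha^-1 ^+ k.+1)) //; last first.
    move=> n; rewrite ind1 mulr1 lee_fin ler_peMr ?(ltW c0) //.
    rewrite lerBrDr -!natrX nat1r ler_nat.
    by rewrite ltn_exp2r.
  by rewrite expeS; elim: k {d_ge0 c0} => [|k IH]; rewrite ?mule1 // expeS IH.
have [h sh hmin] := @ex_minnP (fun n => ~~ `[< stays n w >])
  (ex_intro _ h0 (introN (asboolP _) sh0)).
have indE n : \1_(stays n) w = (n < h)%:R :> R.
  rewrite indicE; case: ltnP => nh.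
    rewrite mem_set //; apply/asboolP; apply: contraTT nh => nw.
    by rewrite -leqNgt hmin.
  by rewrite memNset // => /(staysS nh) sw; move: sh; rewrite asboolT.
rewrite (nneseries_trunc (h := h)); first last.
- by move=> n hn; rewrite indE ltnNge hn mulr0.
- by move=> n; rewrite lee_fin indE mulr_ge0 // invr_ge0 ltW.
rewrite (nneseries_trunc (h := h)); first last.
- by move=> n hn; rewrite indE ltnNge hn mulr0.
- by move=> n; rewrite lee_fin indE mulr_ge0 // mulr_ge0 // ltW.
rewrite !sumEFin -EFin_expe; congr EFin.
rewrite (eq_big_nat _ _ (F2 := fun=> alpha^-1)); last first.
  by move=> n /andP[_ nh]; rewrite indE nh mulr1.
rewrite [RHS](eq_big_nat _ _ (F2 := fun n =>
    alpha^-1 ^+ k.+1 * (n.+1%:R ^+ k.+1 - n%:R ^+ k.+1))); last first.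
  by move=> n /andP[_ nh]; rewrite indE nh mulr1.
rewrite -mulr_sumr telescope_sumr // sumr_const_nat subn0 expr0n subr0.
by rewrite -[X in X ^+ _]mulr_natr exprMn.
Qed.

(** First-step analysis for the probability of being in [iD] at times 1, ..., m, with no condition
    at time 0. *)
Fixpoint stay_prob m (x : V) : R :=
  if m is m'.+1 then \sum_(y <- iD) transition G x y * stay_prob m' y else 1.

Definition cylinder v n : set (mc_space X) :=
  [set w | forall i, (i <= n)%N -> proc i w = v i].

Lemma measurable_cylinder v n : measurable (cylinder v n).
Proof.
have -> : cylinder v n = \bigcap_(i in [set i | (i <= n)%N]) (proc i @^-1` [set v i]).
  by apply/seteqP; split => w sw i; exact: sw.
by apply: bigcap_measurableType => i _; exact: proc_measurable.
Qed.

(* The Markov property is only available for complete histories, so the history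
   up to time [n] is kept as a prefix and the induction runs on the future. *)
Lemma law_cylinder_stays x v n m :
  law X x (cylinder v n `&`
           [set w | forall i, (n < i <= n + m)%N -> proc i w \in iD]) =
  (law X x (cylinder v n) * (stay_prob m (v n))%:E)%E.
Proof.
elim: m n v => [|m IH] n v.
  rewrite mule1; congr (law X x _); apply/seteqP; split => w /=; first by case.
  by move=> wv; split=> // i; rewrite addn0 => /andP[]; case: ltngtP.
(* [u y] prolongs the history [v] by the value [y] at time [n.+1]; the event is then split according
   to that value. *)
pose u y i := if i == n.+1 then y else v i.
pose B y : set (mc_space X) := cylinder (u y) n.+1 `&`
  [set w | forall i, (n.+1 < i <= n.+1 + m)%N -> proc i w \in iD].
have -> : cylinder v n `&`
    [set w | forall i, (n < i <= n + m.+1)%N -> proc i w \in iD] =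
    \big[setU/set0]_(y <- iD) B y.
  rewrite -bigcup_fset; apply/seteqP; split => w /=.
    move=> [wv wD]; exists (proc n.+1 w); first by apply: wD; lia.
    split=> [i|i /andP[ni im]]; last by apply: wD; lia.
    by rewrite /u leq_eqVlt ltnS; case: eqP => [->//|_ /=]; exact: wv.
  move=> [y yD [wu wD]]; split=> [i ni|i /andP[ni im]].
    by rewrite wu ?leqW // /u; case: eqP ni => // ->; rewrite ltnn.
  have [in1|in1] := leqP i n.+1; last by apply: wD; lia.
  have -> : i = n.+1 by lia.
  by rewrite wu // /u eqxx.
have mB y : measurable (B y).
  apply: measurableI; first exact: measurable_cylinder.
  rewrite (_ : [set w | _] = \bigcap_(i in [set i | (n.+1 < i <= n.+1 + m)%N])
      (proc i @^-1` [set x | x \in iD])); last first.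
    by apply/seteqP; split => w sw i; exact: sw.
  by apply: bigcap_measurableType => i _; exact: proc_measurable.
rewrite measure_fbigsetU //; last first.
  move=> y z _ _ [w [[wy _] [wz _]]].
  by have := wy _ (leqnn n.+1); rewrite (wz _ (leqnn n.+1)) /u eqxx.
have lawB y : law X x (B y) =
    (law X x (cylinder v n) * (transition G (v n) y * stay_prob m y)%:E)%E.
  have un : u y n = v n by rewrite /u ltn_eqF.
  have un1 : u y n.+1 = y by rewrite /u eqxx.
  rewrite IH /cylinder proc_markov un un1 -muleA -EFinM.
  congr (law X x _ * _)%E; apply/seteqP; split => w wu i ni; rewrite wu //.
    by rewrite /u ltn_eqF.
  by rewrite /u ltn_eqF.
rewrite (eq_bigr _ (fun y _ => lawB y)).
have /fineK <- : law X x (cylinder v n) \is a fin_num.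
  by apply: fin_num_measure; exact: measurable_cylinder.
under eq_bigr do rewrite -EFinM.
by rewrite sumEFin -EFinM mulr_sumr.
Qed.

Lemma law_stays x n : x \in iD -> law X x (stays n) = (stay_prob n x)%:E.
Proof.
move=> xD; have := law_cylinder_stays x (fun=> x) 0 n.
have C0 : cylinder (fun=> x) 0 = [set w | proc 0%N w = x].
  by apply/seteqP; split => w /= wx; [exact: wx|move=> [|i]].
rewrite C0 proc_start mul1e => <-.
have mC : measurable [set w : mc_space X | proc 0%N w = x].
  by rewrite -C0; exact: measurable_cylinder.
(* The chain starts at [x] almost surely, so intersecting with that event keeps the probability. *)
have -> : law X x (stays n) = law X x (stays n `&` [set w | proc 0%N w = x]).
  rewrite [LHS](measureDI (law X x) (measurable_stays n) mC).
  rewrite [X in (X + _)%E](_ : _ = 0%E) ?add0e //.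
  apply: (@subset_measure0 _ _ _ (law X x) _ (~` [set w | proc 0%N w = x])).
  - exact: measurableD (measurable_stays n) mC.
  - exact: measurableC.
  - exact: subDsetr.
  - by rewrite [LHS]probability_setC // proc_start subee.
congr (law X x _); rewrite setIC; apply/seteqP; split => w /= [w0 sw]; split=> //.
  by move=> i /andP[_ ni]; exact: sw.
by case=> [_|i ni]; [rewrite w0 | exact: sw].
Qed.

End ExitTime.

(** * Exit time moments in terms of the spectrum *)

Section ExitMoments.
Context (R : realType).
Implicit Types (S : seq R) (a : R -> R) (alpha : R).

(* The moments of the exit time, computed by summation by parts from
   [P(eta > n) = sum_l a_l (1 - l / alpha)^n]. *)
Definition exit_moment alpha S a k : R :=
  if k is k'.+1 then
    alpha^-1 ^+ k * \sum_(l <- S) a l * geom_moment k (1 - l / alpha)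
  else \sum_(l <- S) a l.

(* For [eta] geometric with success probability [p], the rising factorial
   moment [E(eta (eta + 1) ... (eta + k - 1))] is [k! / p^k]. *)
Definition exit_coef alpha k j : R :=
  (rising_poly R k)`_j * alpha ^+ j * alpha^-1 ^+ k / k`!%:R.

(** The moment spectrum starts at order 1; this keeps A_{1,0} out of the formulas for the m_k with k
    > 0. *)
Lemma exit_coefS0 alpha k : exit_coef alpha k.+1 0 = 0.
Proof. by rewrite /exit_coef coef0_rising_polyS !mul0r. Qed.

(** For k > 0, [sum_geom_moment] at r = 1 - l / alpha gives k! (alpha / l)^k; dividing by k! alpha^k
    and summing against [a] gives m_k. *)
Lemma spectral_exit_moment alpha S a k M : 0 < alpha ->
  (forall l, l \in S -> 0 < l < 2 * alpha) -> (k < M)%N ->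
  spectral_moment S a k =
  \sum_(j < M) exit_coef alpha k j * exit_moment alpha S a j.
Proof.
move=> a0 S_int kM; have aN0 : alpha != 0 by rewrite gt_eqF.
transitivity (\sum_(j < k.+1) exit_coef alpha k j * exit_moment alpha S a j);
  last first.
  (* Every M > k gives the same sum, because the rising factorial has degree [k]. *)
  rewrite (big_ord_widen M (fun j => exit_coef alpha k j * exit_moment alpha S a j)) //.
  rewrite big_mkcond; apply: eq_bigr => j _; case: ltnP => // kj.
  by rewrite /exit_coef nth_default ?size_rising_poly // !mul0r.
case: k kM => [|k] _.
  rewrite big_ord1 /exit_coef /rising_poly big_ord0 coef1 !expr0 !mul1r invr1 mul1r.
  by apply: eq_bigr => l _; rewrite mulr1.
have r1 l : l \in S -> `|1 - l / alpha| < 1.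
  move=> /S_int/andP[l0 l2]; have x0 : 0 < l / alpha by rewrite divr_gt0.
  have x2 : l / alpha < 2 by rewrite ltr_pdivrMr.
  by rewrite ltr_norml; apply/andP; split; lra.
transitivity (\sum_(j < k.+2) \sum_(l <- S) alpha^-1 ^+ k.+1 / k.+1`!%:R *
    (a l * ((rising_poly R k.+1)`_j * geom_moment j (1 - l / alpha)))).
  rewrite exchange_big; apply: eq_big_seq => l lS /=.
  rewrite -mulr_sumr -mulr_sumr sum_geom_moment ?r1 //.
  have -> : 1 - (1 - l / alpha) = l / alpha by rewrite opprB addrC subrK.
  rewrite invf_div exprMn [alpha^-1 ^+ _]exprVn.
  have l0 : l != 0 by case/S_int/andP: lS => l0 _; rewrite gt_eqF.
  have f0 : k.+1`!%:R != 0 :> R by rewrite pnatr_eq0 -lt0n fact_gt0.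
  by field; rewrite f0 expf_neq0.
(* At j = 0 [exit_moment] is the total mass whereas [geom_moment] is 0, but the coefficient vanishes
   on both sides. *)
apply: eq_bigr => -[[|j] jk] _ /=.
  rewrite exit_coefS0 mul0r big1 // => l _.
  by rewrite coef0_rising_polyS mul0r !mulr0.
rewrite /exit_coef mulr_sumr mulr_sumr; apply: eq_bigr => l _.
rewrite [alpha^-1 ^+ j.+1]exprVn; field.
by rewrite expf_neq0 //= pnatr_eq0 -lt0n fact_gt0.
Qed.

End ExitMoments.

Section ExitMomentsOfDomain.
Context (R : realType) (V : choiceType) (G : graph_with_geometry R V)
  (D : finite_subgraph G) (alpha : R).
Local Notation mV := (WV (gweight G)).
Local Notation mE := (WE (gweight G)).
Local Notation iD := (interior_verts D).
Local Notation W := (fun x : iD => mV (val x)).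
Context (Ddom : is_domain D) (Dbd : boundary_verts D != fset0)
  (a_gt0 : 0 < alpha) (reg : weight_regular D alpha).
Context (S : seq R) (e : R -> {ffun iD -> R}) (Se : spectral_data S e).
Let a l := dotW W (e l) (one_iD D).

Lemma spectral_data_interval l : l \in S -> 0 < l < 2 * alpha.
Proof.
have [_ Le _ _ _] := Se; move=> lS; have e0 := spectral_data_neq0 Se lS.
by rewrite (laplace_eigen_gt0 Ddom Dbd e0 (Le _ lS))
  (laplace_eigen_lt Ddom Dbd reg e0 (Le _ lS)).
Qed.

(** On a regular domain the transition operator restricted to [iD] is 1 - Delta / alpha, which
    multiplies [e l] by 1 - l / alpha at each step. *)
Lemma stay_probE n (x : iD) : stay_prob D n (val x) =
  eigen_comb S e (fun l => (1 - l / alpha) ^+ n) x.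
Proof.
have [_ Le _ oneE _] := Se; elim: n x => [|n IH] x.
  by have /ffunP/(_ x) := oneE; rewrite !ffunE.
rewrite [LHS]/= big_seq_fsetE /=.
under eq_bigr do rewrite IH /transition reg ?(valP x) // mulrAC.
rewrite -mulr_suml; set f := eigen_comb _ _ _.
have Lf : laplace f x = alpha * f x - \sum_y mE (val x) (val y) * f y.
  by rewrite ffunE reg ?(valP x).
have /ffunP/(_ x) := iter_eigen_comb (@laplaceE _ _ _ D) (fun l => (1 - l / alpha) ^+ n) 1 Le.
rewrite /= -/f Lf => /eqP; rewrite subr_eq addrC -subr_eq => /eqP <-.
rewrite !ffunE mulr_sumr -sumrB mulr_suml; apply: eq_bigr => l _.
by rewrite expr1 exprS; field; rewrite gt_eqF.
Qed.

(** Integrating [weighted_exit_time_exp] term by term gives a series in P(eta > n), which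
    [stay_probE] expands over the spectrum. *)
Lemma A1E (X : markov_chain G) k : A1 X D k = (exit_moment alpha S a k)%:E.
Proof.
have oneE : one_iD D = eigen_comb S e (fun=> 1) by case: Se.
have sumW n : \sum_(x : iD) stay_prob D n (val x) * mV (val x) =
    \sum_(l <- S) a l * (1 - l / alpha) ^+ n.
  transitivity (dotW W (eigen_comb S e (fun l => (1 - l / alpha) ^+ n)) (one_iD D)).
    by apply: eq_bigr => x _; rewrite stay_probE [one_iD D x]ffunE mulr1.
  by rewrite dotW_eigen_comb; apply: eq_bigr => l _; rewrite mulrC.
case: k => [|k].
  rewrite /A1 (eq_bigr (fun x : iD => (stay_prob D 0 (val x) * mV (val x))%:E)); last first.
    (* The power of order 0 is 1 even where tau is infinite. *)
    move=> x _; under eq_integral do rewrite expe0.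
    by rewrite mul1r integral_cst //= probability_setT !mul1e.
  rewrite sumEFin (sumW 0%N); congr EFin.
  by apply: eq_bigr => l _; rewrite mulr1.
pose c n : R := alpha^-1 ^+ k.+1 * (n.+1%:R ^+ k.+1 - n%:R ^+ k.+1).
have c_ge0 n : 0 <= c n.
  rewrite mulr_ge0 ?exprn_ge0 ?invr_ge0 ?(ltW a_gt0) //.
  by rewrite subr_ge0 lerXn2r ?nnegrE // ler_nat.
have intE (x : iD) : (\int[law X (val x)]_w (weighted_exit_time D w ^+ k.+1) =
    \sum_(0 <= n <oo) (c n * stay_prob D n (val x))%:E)%E.
  under eq_integral do rewrite (weighted_exit_time_exp _ _ a_gt0 reg).
  rewrite integral_nneseries //=; last 2 first.
  - move=> n; apply/measurable_EFinP; apply: measurable_funM => //.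
    by apply: measurable_indic; exact: measurable_stays.
  - by move=> n w _; rewrite lee_fin mulr_ge0 // c_ge0.
  apply: eq_eseriesr => n _.
  rewrite (integralZl_indic _ (fun=> @stays R V G X D n)) //=; last 2 first.
  - by rewrite ltNge c_ge0.
  - exact: measurable_stays.
  rewrite integral_indic //; last exact: measurable_stays.
  by rewrite setIT [RHS]EFinM; congr (_ * _)%E; exact: law_stays (valP x).
have sp_ge0 n (x : iD) : 0 <= stay_prob D n (val x).
  by rewrite -lee_fin -(@law_stays _ _ _ X) ?(valP x).
rewrite /A1 (eq_bigr (fun x : iD =>
    \sum_(0 <= n <oo) (c n * (stay_prob D n (val x) * mV (val x)))%:E)%E); last first.
  move=> x _; rewrite intE muleC -nneseriesZl; last first.
    by move=> n _; rewrite lee_fin mulr_ge0.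
  by apply: eq_eseriesr => n _; rewrite -EFinM; congr EFin; ring.
rewrite -nneseries_sum; last first.
  move=> x n _; rewrite lee_fin; apply: mulr_ge0 => //; apply: mulr_ge0 => //.
  exact/ltW/WV_gt0.
under eq_eseriesr do rewrite sumEFin -mulr_sumr sumW.
apply: cvg_lim => //.
have r1 l : l \in S -> `|1 - l / alpha| < 1.
  move=> /spectral_data_interval/andP[l0 l2].
  have x0 : 0 < l / alpha by rewrite divr_gt0.
  have x2 : l / alpha < 2 by rewrite ltr_pdivrMr.
  by rewrite ltr_norml; apply/andP; split; lra.
(* The numbers 1 - l / alpha may be negative, so the sum over [S] is exchanged with the series
   through convergence of real partial sums, not through nonnegativity. *)
apply: cvg_EFin; first by apply: nearW => n; rewrite sumEFin.
rewrite (_ : (fine \o _) = fun n => alpha^-1 ^+ k.+1 *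
    \sum_(l <- S | l \in S) a l * series (geom_diff k.+1 (1 - l / alpha)) n).
  rewrite /exit_moment big_seq; apply: cvgMr; apply: cvg_big => [|l lS].
    exact: add_continuous.
  by apply: cvgMr; apply: is_cvg_series_geom_diff; exact: r1.
apply/funext => n /=; rewrite sumEFin -big_seq /= mulr_sumr.
under eq_bigr do rewrite mulr_sumr.
rewrite exchange_big; apply: eq_bigr => l _ /=.
rewrite /series /= !mulr_sumr; apply: eq_bigr => i _.
by rewrite /c /geom_diff; ring.
Qed.

End ExitMomentsOfDomain.

(** * Recovering the spectrum from the Poisson and moment spectra *)

Lemma spectral_data_size (R : realType) (V : choiceType)
    (G : graph_with_geometry R V) (D : finite_subgraph G)
    (S : seq R) (e : R -> {ffun interior_verts D -> R}) N :
  spectral_data S e -> (spec_star D #= `I_N)%card -> size S = N.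
Proof.
case=> Su _ _ _ <- SN; rewrite -(card_fset_set SN); apply: perm_size.
apply: uniq_perm => // [|l]; first exact: fset_uniq.
by rewrite in_fset_set; [apply/idP/idP; rewrite inE | exact: finite_seq].
Qed.

Theorem theorem1p2 (R : realType) (V : choiceType)
    (G : graph_with_geometry R V) :
  [/\ (forall D D' : finite_subgraph G,
         is_domain D -> boundary_verts D != fset0 ->
         is_domain D' -> boundary_verts D' != fset0 ->
         pspec D = pspec D' -> spec_star D = spec_star D'),
      (forall N : nat, (0 < N)%N ->
         exists f : 'I_N -> ratfun R (2 * N),
           forall D : finite_subgraph G,
             is_domain D -> boundary_verts D != fset0 ->
             (spec_star D #= `I_N)%card ->
             recovers f (A2 D) (spec_star D))
    & (forall alpha : R, 0 < alpha ->
         (forall (X : markov_chain G) (D D' : finite_subgraph G),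
            is_domain D -> boundary_verts D != fset0 -> weight_regular D alpha ->
            is_domain D' -> boundary_verts D' != fset0 -> weight_regular D' alpha ->
            mspec X D = mspec X D' -> spec_star D = spec_star D') /\
         (forall N : nat, (0 < N)%N ->
            exists f : 'I_N -> ratfun R (2 * N),
              forall (X : markov_chain G) (D : finite_subgraph G),
                is_domain D -> boundary_verts D != fset0 -> weight_regular D alpha ->
                (spec_star D #= `I_N)%card ->
                recovers f (A1 X D) (spec_star D)))].
Proof.
have S_gt0 (D : finite_subgraph G) S (e : R -> {ffun interior_verts D -> R}) :
    is_domain D -> boundary_verts D != fset0 -> spectral_data S e ->
    forall l, l \in S -> 0 < l.
  move=> Ddom Dbd Se l lS; have [_ Le _ _ _] := Se.
  exact: laplace_eigen_gt0 Ddom Dbd (spectral_data_neq0 Se lS) (Le _ lS).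
have fact_neq0 k : k`!%:R != 0 :> R by rewrite pnatr_eq0 -lt0n fact_gt0.
split=> [D D' Ddom Dbd Ddom' Dbd' DD'|N _|alpha a0].
- have [S [e Se]] := spectral_data_exists D.
  have [S' [e' Se']] := spectral_data_exists D'.
  have [[Su _ ap _ <-] [Su' _ ap' _ <-]] := (Se, Se').
  apply: moments_support_inj ap _ _ ap' _ => // [||k].
  + exact: S_gt0 Se.
  + exact: S_gt0 Se'.
  have := congr1 (fun s => s k) DD'; rewrite /pspec (A2E _ Ddom Dbd Se).
  by rewrite (A2E _ Ddom' Dbd' Se') => -[] /(mulfI (fact_neq0 _)).
(* As A_{2,k} = k! m_k, the change of sequence is diagonal with entries 1 / k!. *)
- have [f fP] := @moment_ratfun R N (fun k j => (k == j)%:R / k`!%:R).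
  exists f => D Ddom Dbd SN; have [S [e Se]] := spectral_data_exists D.
  have [Su _ ap _ SE] := Se; rewrite -SE.
  pose a l := dotW (fun x => WV (gweight G) (val x)) (e l) (one_iD D).
  apply: (fP _ (fun k => k`!%:R * spectral_moment S a k) _ a Su _ _ ap).
  + exact: spectral_data_size Se SN.
  + exact: S_gt0 Se.
  + by move=> j _; rewrite (A2E _ Ddom Dbd Se).
  + move=> k kN; rewrite (bigD1 (Ordinal kN)) //= eqxx mul1r mulKf // big1 ?addr0 //.
    by move=> j jk; rewrite eq_sym [_ == _](negPf jk) !mul0r.
- split=> [X D D' Ddom Dbd reg Ddom' Dbd' reg' DD'|N _].
    have [S [e Se]] := spectral_data_exists D.
    have [S' [e' Se']] := spectral_data_exists D'.
    have [[Su _ ap _ <-] [Su' _ ap' _ <-]] := (Se, Se').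
    apply: moments_support_inj ap _ _ ap' _ => // [||k].
    + exact: S_gt0 Se.
    + exact: S_gt0 Se'.
    rewrite !(@spectral_exit_moment _ alpha _ _ _ k.+2) //; last 2 first.
    + exact: spectral_data_interval Se'.
    + exact: spectral_data_interval Se.
    apply: eq_bigr => -[[|j] jk] _; first by rewrite exit_coefS0 !mul0r.
    have := congr1 (fun s => s j) DD'; rewrite /mspec (A1E Ddom Dbd a0 reg Se).
    by rewrite (A1E Ddom' Dbd' a0 reg' Se') => -[/= ->].
  (* The coefficients depend only on [alpha] and the indices, so the same rational functions serve
     every regular domain and every chain. *)
  have [f fP] := moment_ratfun N (exit_coef alpha).
  exists f => X D Ddom Dbd reg SN; have [S [e Se]] := spectral_data_exists D.
  have [Su _ ap _ SE] := Se; rewrite -SE.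
  pose a l := dotW (fun x => WV (gweight G) (val x)) (e l) (one_iD D).
  apply: (fP _ (exit_moment alpha S a) _ a Su _ _ ap).
  + exact: spectral_data_size Se SN.
  + exact: S_gt0 Se.
  + by move=> j _; rewrite (A1E Ddom Dbd a0 reg Se).
  + move=> k kN; apply: spectral_exit_moment => //.
    exact: spectral_data_interval Se.
Qed.
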